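(* For each $n$, let $X^{(n)}\sim P\in\mathcal{P}^{(n)}$ take values in $\mathcal{X}^{(n)}$, where every $P\in\mathcal{P}^{(n)}$ has a density $p=dP/d\nu$ with respect to a common dominating measure $\nu$. Let estimators take values in a set $\mathcal{A}$ and let $\ell_n:\mathcal{P}^{(n)}\times\mathcal{A}\to\mathbb{R}^+$ be a loss function bounded by $L_n<\infty$ for all $n$. Assume: (A1) for all $a\in\mathcal{A}$ and $P,P'\in\mathcal{P}^{(n)}$, $|\ell_n(P,a)-\ell_n(P',a)|\le c_n\|P-P'\|$, where $\|\cdot\|$ is the variational norm; (A2) given $\varepsilon>0$ there exists a finite set $\mathcal{P}_K^{(n)}\subset\mathcal{P}^{(n)}$ with cardinality $\kappa_{n,\varepsilon}$ such that $\sup_{P\in\mathcal{P}^{(n)}}\inf_{P'\in\mathcal{P}_K^{(n)}}\|P-P'\|\le\varepsilon$; (A3) with $R_n(P,\delta)=\mathsf{E}_P\,\ell_n(P,\delta(X^{(n)}))$ for (possibly randomized) procedures $\delta$ and $R_n(\delta)=\sup_{P\in\mathcal{P}^{(n)}}R_n(P,\delta)$, there exists $\delta^*$ such that $R_n(\delta^* )=\inf_\delta R_n(\delta)\equiv r_n\le r<\infty$ for all $n$. Then for all $\varepsilon'>0$ there exist probability measures $\mu_{n,\varepsilon'}$ on $\mathcal{P}^{(n)}$ such that $R_n(\delta_{\mu_{n,\varepsilon'}})\le r_n+\varepsilon'$.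
   Context: A procedure $\delta$ is a map $\delta:\mathcal{X}^{(n)}\to\mathcal{A}$ or, more generally, a randomized procedure (a Markov kernel from $\mathcal{X}^{(n)}$ to $\mathcal{A}$). For a probability measure $\mu_n$ supported on a finite set $\mathcal{P}_K^{(n)}=\{P_1,\ldots,P_\kappa\}$ the posterior is $\mu_n(P_j\mid X^{(n)})=\mu_n(P_j)p_j(X^{(n)})/\sum_{k=1}^{\kappa}\mu_n(P_k)p_k(X^{(n)})$, and $\delta_{\mu_n}$ denotes the Bayesian procedure with respect to the prior $\mu_n$ (and loss $\ell_n$), i.e. one minimizing the Bayes risk (posterior expected loss).
   Formalization: Added assumption: the infimum of the maximal risk is also attained on the finite sets of (A2); without it a Bayes procedure may exist for no prior. The bound is shown for some Bayes procedure for the prior, not for every one in case of ties. *)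

(* Defs.v *)
From HB Require Import structures.
From mathcomp Require Import all_boot all_order all_algebra.
From mathcomp Require Import all_classical all_reals all_analysis.

Set Implicit Arguments.
Unset Strict Implicit.
Unset Printing Implicit Defensive.

Import Order.TTheory GRing.Theory Num.Theory.

Local Open Scope classical_set_scope.
Local Open Scope ring_scope.
Local Open Scope ereal_scope.

Section variational_norm.
Context d (T : measurableType d) (R : realType).

(* |nu|(T), with |nu| the variation of the signed measure nu.  The Hahn
   decomposition is chosen, but |nu| does not depend on the choice. *)
Definition total_variation (nu : {charge set T -> \bar R}) : \bar R :=
  let hahn := cid (Hahn_decomposition nu) in
  charge_variation (projT2 (cid (projT2 hahn))) setT.

(* With this normalisation the distance of two mutually singular probability
   measures is 2. *)
Definition variation_dist (P Q : probability T R) : \bar R :=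
  total_variation
    (cadd (charge_of_finite_measure P) (copp (charge_of_finite_measure Q))).

End variational_norm.

Section decision_problem.
Context d (T : measurableType d) dA (A : measurableType dA) (R : realType).
Implicit Types (PP F : set (probability T R)) (P : probability T R).

Definition has_density (nu : {measure set T -> \bar R}) P : Prop :=
  exists p : T -> R,
    [/\ measurable_fun setT p, (forall x, (0 <= p x)%R) &
        forall B, measurable B -> P B = \int[nu]_(x in B) (p x)%:E].

(* Randomized procedures are the Markov kernels from T to A; a nonrandomized
   procedure is a kernel of Dirac measures. *)
Definition risk (l : probability T R -> A -> R) P (delta : R.-pker T ~> A)
    : \bar R :=
  \int[P]_x \int[delta x]_a (l P a)%:E.

Definition max_risk (l : probability T R -> A -> R) PP
    (delta : R.-pker T ~> A) : \bar R :=
  ereal_sup [set risk l P delta | P in PP].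

Definition minimax_risk (l : probability T R -> A -> R) PP : \bar R :=
  ereal_inf [set max_risk l PP delta | delta in [set: R.-pker T ~> A]].

Definition is_minimax (l : probability T R -> A -> R) PP
    (delta : R.-pker T ~> A) : Prop :=
  max_risk l PP delta = minimax_risk l PP.

(* mu is (the mass function of) a probability measure on PP supported on the
   finite subset F; some points of F may have mass zero. *)
Definition finite_prior PP F (mu : probability T R -> R) : Prop :=
  [/\ finite_set F, F `<=` PP, (forall P, (0 <= mu P)%R),
      (forall P, ~ F P -> mu P = 0%R) & (\sum_(P \in F) mu P)%R = 1%R].

Definition bayes_risk (l : probability T R -> A -> R) F
    (mu : probability T R -> R) (delta : R.-pker T ~> A) : \bar R :=
  \sum_(P \in F) (mu P)%:E * risk l P delta.

Definition is_bayes (l : probability T R -> A -> R) F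
    (mu : probability T R -> R) (delta : R.-pker T ~> A) : Prop :=
  forall delta', bayes_risk l F mu delta <= bayes_risk l F mu delta'.

End decision_problem.

(* Main.v *)
Require Import Defs.
From HB Require Import structures.
From mathcomp Require Import all_boot all_order all_algebra.
From mathcomp Require Import all_classical all_reals all_analysis.
From mathcomp Require Import finmap measurable_realfun ring lra.

(** Two facts make the theorem true.

    A finite model has a least favorable prior.  Randomizing between two
    procedures by a coin averages their risks, so the risk vectors
    [(risk l P delta)_(P in F)] of all procedures form a convex set of R^F.  Let
    [v] be the minimax risk over [F].  No risk vector lies in the open orthant
    where every coordinate is below [v], so some probability vector [mu] puts
    the whole convex set in the half-space [v <= sum_P mu P * y_P]: every
    procedure has Bayes risk at least [v] for [mu].  A procedure that is minimax
    over [F] has risk at most [v] at every point of [F], hence Bayes risk at most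
    [v], so it is Bayes for [mu] ([exists_least_favorable_prior]).  The
    separating [mu] is built by induction on the number of coordinates
    ([mixable_max_ge0]), from the case of two functions
    ([mixable_max2_ge0]), where it is the choice of a single real number.

    The risk of one fixed procedure is Lipschitz in the model for the variational
    norm, with constant [`|c| + L] uniform over procedures
    ([risk_le_add_variation_dist]): moving [P] changes the loss by at most
    [c * variation_dist P Q], and changes the law under which a posterior loss in
    [[0, L]] is integrated, which costs at most [L * variation_dist P Q].

    For [F] an [eps]-net of the model, the procedure that is minimax over [F] is
    then Bayes, its risk over [F] is at most the minimax risk over [F], which is
    below the minimax risk over the whole model, and passing from [F] to the
    whole model costs a multiple of [eps]. *)

Import Order.TTheory GRing.Theory Num.Theory.

Local Open Scope classical_set_scope.
Local Open Scope ring_scope.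

(** * Separating a convex set of vectors from the negative orthant *)

(** This says that the image of [S] under [(f i)_(i in J)] is a convex subset of
    R^J.  Convexity is put on the image because [D] is meant to be a type of
    kernels, which carries no convex structure. *)
Definition mixable {R : realType} {D I : Type} (J : set I)
    (f : I -> D -> R) (S : set D) :=
  forall t x y, 0 <= t <= 1 -> S x -> S y ->
    exists2 z, S z & forall i, J i -> f i z = t * f i x + (1 - t) * f i y.

(** A point [x] with [f x < 0 <= g x] bounds the admissible [t] from above by
    [g x / (g x - f x)], and a point [y] with [g y < 0 <= f y] bounds it from
    below by [- g y / (f y - g y)].  If a lower bound exceeded an upper bound, the
    segment from [(f x, g x)] to [(f y, g y)] would meet the open negative
    quadrant, so the supremum of the lower bounds is admissible. *)
Lemma mixable_max2_ge0 {R : realType} {D : Type} (f g : D -> R) (S : set D) :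
    mixable setT (fun b : bool => if b then f else g) S ->
    (forall x, S x -> 0 <= f x \/ 0 <= g x) ->
  exists2 t, 0 <= t <= 1 & forall x, S x -> 0 <= t * f x + (1 - t) * g x.
Proof.
move=> mixfg fg_ge0.
have cross x y : S x -> S y -> f x < 0 -> g y < 0 ->
    - g y * (g x - f x) <= g x * (f y - g y).
  move=> Sx Sy fx0 gy0.
  have gx0 : 0 <= g x by case: (fg_ge0 x Sx) => // ?; lra.
  have fy0 : 0 <= f y by case: (fg_ge0 y Sy) => // ?; lra.
  rewrite leNgt; apply/negP => lt_cross.
  (* With weights proportional to a and b, both f and g are negative at the
     mixture of x and y. *)
  pose a := f y - g y; pose b := g x - f x.
  have ab0 : 0 < a + b by rewrite /a /b; lra.
  have t01 : 0 <= a / (a + b) <= 1.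
    by rewrite divr_ge0 ?ler_pdivrMr ?mul1r /a /b //=; lra.
  have [z Sz fgz] := mixfg _ _ _ t01 Sx Sy.
  have onemE : 1 - a / (a + b) = b / (a + b) by field; lra.
  have combE p q : a / (a + b) * p + (1 - a / (a + b)) * q
      = (a * p + b * q) / (a + b) by rewrite onemE; field; lra.
  case: (fg_ge0 z Sz).
  - rewrite (fgz true I) combE; apply/negP; rewrite -ltNge.
    by rewrite ltr_pdivrMr// mul0r /a /b; nra.
  - rewrite (fgz false I) combE; apply/negP; rewrite -ltNge.
    by rewrite ltr_pdivrMr// mul0r /a /b; nra.
(* The point 0 makes the set of lower bounds nonempty and its supremum
   nonnegative. *)
pose lo := [set t | t = 0 \/
  exists y, [/\ S y, g y < 0 & t = - g y / (f y - g y)]].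
have lo1 : ubound lo 1.
  move=> t [->|[y [Sy gy0 ->]]]; first by rewrite ler01.
  have fy0 : 0 <= f y by case: (fg_ge0 y Sy) => // ?; lra.
  by rewrite ler_pdivrMr; lra.
have lo_sup : has_sup lo by split; [exists 0; left|exists 1].
exists (sup lo).
  by rewrite ge_sup ?andbT; [apply: ub_le_sup; [exists 1|left]|exists 0; left|].
move=> x Sx.
have [fx0|fx0] := ltP (f x) 0; last have [gx0|gx0] := ltP (g x) 0.
- have gx0 : 0 <= g x by case: (fg_ge0 x Sx) => // ?; lra.
  have d0 : 0 < g x - f x by lra.
  have : sup lo <= g x / (g x - f x).
    apply: ge_sup; first by exists 0; left.
    move=> t [->|[y [Sy gy0 ->]]]; first by rewrite divr_ge0// ltW.
    have fy0 : 0 <= f y by case: (fg_ge0 y Sy) => // ?; lra.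
    rewrite ler_pdivrMr; last by lra.
    by rewrite mulrAC ler_pdivlMr//; exact: cross.
  by rewrite ler_pdivlMr//; lra.
- have : - g x / (f x - g x) <= sup lo.
    by apply: ub_le_sup; [exists 1|right; exists x].
  by rewrite ler_pdivrMr; lra.
- have s0 : 0 <= sup lo by apply: ub_le_sup; [exists 1|left].
  have s1 : sup lo <= 1 by apply: ge_sup => //; exists 0; left.
  by nra.
Qed.

(** A theorem of the alternative for convex sets in finite dimension.  On the
    points where the first function is negative, the others satisfy the same
    hypothesis, so by induction some average [g] of them is nonnegative there;
    then [max (f j) g] is nonnegative on all of [S], and the case of two functions
    applies to [f j] and [g]. *)
Lemma mixable_max_ge0 {R : realType} {D : Type} {I : eqType} (s : seq I)
    (f : I -> D -> R) (S : set D) :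
    uniq s -> S !=set0 -> mixable [set` s] f S ->
    (forall x, S x -> exists2 i, i \in s & 0 <= f i x) ->
  exists mu : I -> R, [/\ forall i, 0 <= mu i, forall i, i \notin s -> mu i = 0,
    \sum_(i <- s) mu i = 1 &
    forall x, S x -> 0 <= \sum_(i <- s) mu i * f i x].
Proof.
elim: s S => [|j s IH] S /= => [_ [x Sx] _ /(_ x Sx)[]//|].
move=> /andP[js us] S0 mixf maxf.
pose T := S `&` [set x | f j x < 0].
have [T0|/set0P T0] := eqVneq T set0.
  exists (fun i => (i == j)%:R); split.
  - by [].
  - by move=> i; rewrite inE negb_or => /andP[/negbTE->].
  - rewrite big_cons eqxx big_seq big1 ?addr0// => i si.
    by case: eqP => // ij; rewrite -ij si in js.
  - move=> x Sx; rewrite big_cons eqxx mul1r big_seq big1 ?addr0.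
      by rewrite leNgt; apply/negP => fx0; have : T x by []; rewrite T0.
    by move=> i si; case: eqP => [ij|_]; rewrite ?mul0r//; rewrite -ij si in js.
have mixT : mixable [set` s] f T.
  move=> t x y t01 [Sx /= fx0] [Sy /= fy0].
  have [z Sz fz] := mixf _ _ _ t01 Sx Sy; exists z.
    by split => //=; rewrite fz /= ?mem_head//; case/andP: t01 => ? ?; nra.
  by move=> i si; apply: fz; rewrite /= inE si orbT.
have [|mu [mu0 mus mu1 muf]] := IH T us T0 mixT.
  move=> x [Sx fx0]; have [i] := maxf x Sx; rewrite inE => /orP[/eqP->|si fi].
    by rewrite leNgt fx0.
  by exists i.
pose g x := \sum_(i <- s) mu i * f i x.
have [||t /andP[t0 t1] tfg] := mixable_max2_ge0 (f j) g S.
- move=> t x y t01 Sx Sy; have [z Sz fz] := mixf _ _ _ t01 Sx Sy.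
  exists z => // -[] _; first by apply: fz; rewrite /= mem_head.
  rewrite /g !mulr_sumr -big_split /=; apply: eq_big_seq => i si.
  by rewrite fz /= ?inE ?si ?orbT//; ring.
- move=> x Sx; have [fx0|?] := ltP (f j x) 0; last by left.
  by right; apply: muf.
exists (fun i => t * (i == j)%:R + (1 - t) * mu i); split.
- by move=> i; rewrite addr_ge0// mulr_ge0// subr_ge0.
- move=> i; rewrite inE negb_or => /andP[/negbTE-> /mus->].
  by rewrite !mulr0 addr0.
- rewrite big_cons eqxx mus// mulr0 addr0 mulr1.
  rewrite (eq_big_seq (fun i => (1 - t) * mu i)) => [|i si].
    by rewrite -mulr_sumr mu1; ring.
  by case: eqP => [ij|_]; [rewrite -ij si in js|rewrite mulr0 add0r].
- move=> x Sx; have := tfg x Sx.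
  rewrite big_cons eqxx mus// mulr0 addr0 mulr1 /g mulr_sumr.
  congr (_ <= _ + _); apply: eq_big_seq => i si.
  case: eqP => [ij|_]; first by rewrite -ij si in js.
  by rewrite mulr0 add0r mulrA.
Qed.

(** * Risks: mixtures of procedures and continuity in the model *)

Local Open Scope ereal_scope.

(** With [P - Q = nu^+ - nu^-] the Jordan decomposition, [P] is dominated by the
    measure [Q + nu^+], and [nu^+] has mass at most the total variation. *)
Lemma integral_le_add_variation_dist {d} {T : measurableType d} {R : realType}
    (P Q : probability T R) (f : T -> \bar R) (L : R) :
    measurable_fun setT f -> (forall x, 0 <= f x <= L%:E) ->
  \int[P]_x f x <= \int[Q]_x f x + L%:E * variation_dist P Q.
Proof.
move=> mf f0L.
have f0 x : 0 <= f x by case/andP: (f0L x).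
have fL x : f x <= L%:E by case/andP: (f0L x).
rewrite /variation_dist /Defs.total_variation.
set nu : {charge set T -> \bar R} := cadd _ _.
case: (cid (Hahn_decomposition nu)) => /= pos neg_ex.
case: (cid neg_ex) => /= neg hahn.
have PQ B : measurable B -> P B <= measure_add Q (jordan_pos hahn) B.
  move=> mB; rewrite measure_addE.
  have : nu B <= jordan_pos hahn B.
    rewrite (jordan_decomp hahn mB) /cadd /=.
    by rewrite -[leRHS]adde0 leeD2l// /cscale mulN1e oppe_le0.
  rewrite -[nu B]/(P B - Q B) leeBlDl//.
  exact: fin_num_measure.
apply: (@le_trans _ _ (\int[measure_add Q (jordan_pos hahn)]_x f x)).
  exact: ge0_le_measure_integral.
rewrite ge0_integral_measure_add// leeD2l//.
have L0 : (0 <= L)%R by rewrite -lee_fin (le_trans (f0 point)).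
apply: (@le_trans _ _ (\int[jordan_pos hahn]_x L%:E)).
  by apply: ge0_le_integral => //; exact: measurable_cst.
rewrite integral_cst// /charge_variation lee_wpmul2l ?lee_fin//.
by rewrite leeDl.
Qed.

Section risk_theory.
Context {d} {T : measurableType d} {dA} {A : measurableType dA} {R : realType}.
Implicit Types (delta : R.-pker T ~> A) (P Q : probability T R).

Lemma pker_integral_le delta x (h : A -> \bar R) (L : R) :
    measurable_fun setT h -> (forall a, 0 <= h a <= L%:E) ->
  0 <= \int[delta x]_a h a <= L%:E.
Proof.
move=> mh hL; rewrite integral_ge0/=; last by move=> a _; case/andP: (hL a).
apply: (@le_trans _ _ (\int[delta x]_a L%:E)).
  apply: ge0_le_integral => //; try exact: measurable_cst.
  - by move=> a _; case/andP: (hL a).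
  - by move=> a _; case/andP: (hL a).
by rewrite integral_cst// prob_kernel mule1.
Qed.

Lemma measurable_pker_integral delta (h : A -> \bar R) :
    measurable_fun setT h -> (forall a, 0 <= h a) ->
  measurable_fun setT (fun x => \int[delta x]_a h a).
Proof.
move=> mh h0; apply: measurable_fun_integral_kernel => //.
exact: measurable_kernel.
Qed.

(** The procedure that tosses a coin with success probability [t],
    independently of the data, and then follows [delta1] or [delta2]. *)
Lemma exists_pker_mixture (t : R) delta1 delta2 : (0 <= t <= 1)%R ->
  exists delta, forall x (h : A -> \bar R), measurable_fun setT h ->
    (forall a, 0 <= h a) ->
    \int[delta x]_a h a
      = t%:E * \int[delta1 x]_a h a + (1 - t)%:E * \int[delta2 x]_a h a.
Proof.
move=> /andP[t0 t1].
have s0 : (0 <= 1 - t)%R by rewrite subr_ge0.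
pose k x : {measure set A -> \bar R} :=
  measure_add (mscale (NngNum t0) (delta1 x)) (mscale (NngNum s0) (delta2 x)).
have kE x U : k x U = t%:E * delta1 x U + (1 - t)%:E * delta2 x U.
  exact: measure_addE.
have mk U : measurable U -> measurable_fun [set: T] (k ^~ U).
  move=> mU; under eq_fun do rewrite kE.
  by apply: emeasurable_funD; apply: measurable_funeM; exact: measurable_kernel.
have k1 x : k x [set: A] = 1.
  by rewrite kE !prob_kernel !mule1 -EFinD addrC subrK.
pose kk : R.-ker T ~> A := HB.pack_for (R.-ker T ~> A) k
  (isKernel.Build _ _ T A R k mk).
pose kp : R.-pker T ~> A := HB.pack_for (R.-pker T ~> A) k
  (isKernel.Build _ _ T A R k mk)
  (Kernel_isProbability.Build _ _ T A R kk k1).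
exists kp => x h mh h0.
rewrite /kp /= /k ge0_integral_measure_add//.
by rewrite !ge0_integral_mscale.
Qed.

Lemma risk_bounds (l : probability T R -> A -> R) P delta (L : R) :
    measurable_fun setT (l P) -> (forall a, (0 <= l P a <= L)%R) ->
  0 <= risk l P delta <= L%:E.
Proof.
move=> ml lL.
have mlE : measurable_fun setT (fun a => (l P a)%:E) by exact/measurable_EFinP.
have lLE a : 0 <= (l P a)%:E <= L%:E by rewrite !lee_fin.
have post x := @pker_integral_le delta x _ L mlE lLE.
rewrite /risk integral_ge0/=; last by move=> x _; case/andP: (post x).
apply: (@le_trans _ _ (\int[P]_x L%:E)).
  apply: ge0_le_integral => //; try exact: measurable_cst.
  - by move=> x _; case/andP: (post x).
  - by apply: measurable_pker_integral => // a; case/andP: (lLE a).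
  - by move=> x _; case/andP: (post x).
by rewrite integral_cst//= probability_setT mule1.
Qed.

Lemma risk_mixture (l : probability T R -> A -> R) P (t : R)
    delta delta1 delta2 : (0 <= t <= 1)%R ->
    measurable_fun setT (l P) -> (forall a, (0 <= l P a)%R) ->
    (forall x (h : A -> \bar R), measurable_fun setT h -> (forall a, 0 <= h a) ->
      \int[delta x]_a h a
        = t%:E * \int[delta1 x]_a h a + (1 - t)%:E * \int[delta2 x]_a h a) ->
  risk l P delta = t%:E * risk l P delta1 + (1 - t)%:E * risk l P delta2.
Proof.
move=> /andP[t0 t1] ml l0 mix.
have s0 : (0 <= 1 - t)%R by rewrite subr_ge0.
have mlE : measurable_fun setT (fun a => (l P a)%:E) by exact/measurable_EFinP.
have lE0 a : 0 <= (l P a)%:E by rewrite lee_fin.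
have post0 k x : 0 <= \int[(k : R.-pker T ~> A) x]_a (l P a)%:E.
  by apply: integral_ge0.
have mpost k := @measurable_pker_integral k _ mlE lE0.
rewrite /risk; under eq_integral do rewrite mix//.
rewrite ge0_integralD//.
- by rewrite !ge0_integralZl_EFin.
- by move=> x _; rewrite mule_ge0.
- exact: measurable_funeM.
- by move=> x _; rewrite mule_ge0.
- exact: measurable_funeM.
Qed.

(** The two terms of the constant come from replacing [l P] by [l Q] inside the
    integrals and from replacing [P] by [Q] as the law of the data.  The absolute
    value of [c] allows a negative [c], for which the hypothesis forces
    [l P = l Q] and distance zero. *)
Lemma risk_le_add_variation_dist (l : probability T R -> A -> R) P Q delta
    (L c e : R) :
    measurable_fun setT (l P) -> measurable_fun setT (l Q) ->
    (forall a, (0 <= l P a)%R) -> (forall a, (0 <= l Q a <= L)%R) ->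
    (0 <= e)%R -> variation_dist P Q <= e%:E ->
    (forall a, `| l P a - l Q a |%:E <= c%:E * variation_dist P Q) ->
  risk l P delta <= risk l Q delta + ((`|c| + L) * e)%:E.
Proof.
move=> mP mQ P0 QL e0 PQe lPQ.
have L0 : (0 <= L)%R by case/andP: (QL point) => /le_trans; apply.
have Q0 a : (0 <= l Q a)%R by case/andP: (QL a).
have ce0 : (0 <= `|c| * e)%R by rewrite mulr_ge0.
have dist0 : 0 <= variation_dist P Q.
  rewrite /variation_dist /Defs.total_variation; case: cid => ? ? /=; case: cid => ? ?.
  by rewrite /= /charge_variation adde_ge0.
have loss_le a : (l P a)%:E <= (l Q a)%:E + (`|c| * e)%:E.
  rewrite -EFinD lee_fin -lerBlDl (le_trans (ler_norm _))// -lee_fin.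
  rewrite (le_trans (lPQ a))// EFinM.
  apply: (@le_trans _ _ (`|c|%:E * variation_dist P Q)).
    by rewrite lee_wpmul2r// lee_fin ler_norm.
  by rewrite lee_wpmul2l// lee_fin.
have mE R' : measurable_fun setT (l R') ->
  measurable_fun setT (fun a => (l R' a)%:E) by move=> ?; exact/measurable_EFinP.
have post_le x : \int[delta x]_a (l P a)%:E
    <= \int[delta x]_a (l Q a)%:E + (`|c| * e)%:E.
  apply: (@le_trans _ _ (\int[delta x]_a ((l Q a)%:E + (`|c| * e)%:E))).
    apply: ge0_le_integral => //.
    - by move=> a _; rewrite lee_fin.
    - exact: mE.
    - by apply: emeasurable_funD; [exact: mE|exact: measurable_cst].
  rewrite ge0_integralD//; first by rewrite integral_cst// prob_kernel mule1.
  - by move=> a _; rewrite lee_fin.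
  - exact: mE.
have mpost R' : measurable_fun setT (l R') -> (forall a, 0 <= l R' a)%R ->
    measurable_fun setT (fun x => \int[delta x]_a (l R' a)%:E).
  move=> mR R0; apply: measurable_pker_integral; first exact: mE.
  by move=> a; rewrite lee_fin.
have postQ x : 0 <= \int[delta x]_a (l Q a)%:E <= L%:E.
  by apply: pker_integral_le; [exact: mE|move=> a; rewrite !lee_fin].
have postQ0 x : 0 <= \int[delta x]_a (l Q a)%:E by case/andP: (postQ x).
apply: (@le_trans _ _
    (\int[P]_x (\int[delta x]_a (l Q a)%:E + (`|c| * e)%:E))).
  apply: ge0_le_integral => //.
  - by move=> x _; apply: integral_ge0 => a _; rewrite lee_fin.
  - exact: mpost.
  - by apply: emeasurable_funD; [exact: mpost|exact: measurable_cst].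
rewrite ge0_integralD//; last exact: mpost.
rewrite integral_cst//= probability_setT mule1 mulrDl EFinD addeA [leRHS]addeAC.
rewrite leeD2r//.
apply: (le_trans (integral_le_add_variation_dist P Q _ L (mpost _ mQ Q0) postQ)).
by rewrite leeD2l// EFinM lee_wpmul2l// lee_fin.
Qed.

End risk_theory.

(** * Minimax and Bayes procedures *)

Lemma max_risk_le {d} {T : measurableType d} {dA} {A : measurableType dA}
    {R : realType} (l : probability T R -> A -> R) PP delta (M : \bar R) :
  (forall P, PP P -> risk l P delta <= M) -> max_risk l PP delta <= M.
Proof. by move=> le_M; apply: ge_ereal_sup => _ [P PPP <-]; exact: le_M. Qed.

Lemma risk_le_max_risk {d} {T : measurableType d} {dA} {A : measurableType dA}
    {R : realType} (l : probability T R -> A -> R) PP delta P :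
  PP P -> risk l P delta <= max_risk l PP delta.
Proof. by move=> PPP; apply: ereal_sup_ubound; exists P. Qed.

Lemma le_minimax_risk {d} {T : measurableType d} {dA} {A : measurableType dA}
    {R : realType} (l : probability T R -> A -> R) F PP :
  F `<=` PP -> minimax_risk l F <= minimax_risk l PP.
Proof.
move=> FPP; apply: le_ereal_inf_tmp => _ [delta _ <-].
apply: (@le_trans _ _ (max_risk l F delta)).
  by apply: ereal_inf_lbound; exists delta.
by apply: max_risk_le => P FP; apply/risk_le_max_risk/FPP.
Qed.

(** The minimax theorem for finitely many states of nature: subtracting the
    minimax value [v] from the risks, minimaxity says that the maximum over [F]
    of the differences is nonnegative for every procedure, and the separating
    vector is the prior. *)
Lemma exists_least_favorable_prior {d} {T : measurableType d}
    {dA} {A : measurableType dA} {R : realType}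
    (l : probability T R -> A -> R) (F : set (probability T R)) (L : R) delta :
    finite_set F -> F !=set0 ->
    (forall P, F P -> measurable_fun setT (l P)) ->
    (forall P a, F P -> (0 <= l P a <= L)%R) ->
    is_minimax l F delta ->
  exists mu, finite_prior F F mu /\ is_bayes l F mu delta.
Proof.
move=> finF [P0 FP0] l_meas l_bounded minimax.
pose s : seq (probability T R) := fset_set F.
have sF P : (P \in s) = (P \in F) by rewrite /s in_fset_set.
have FsP P : P \in s -> F P by rewrite sF => /set_mem.
have riskL P k : F P -> 0 <= risk l P k <= L%:E.
  by move=> FP; apply: risk_bounds => [|a]; [exact: l_meas|exact: l_bounded].
have risk_fin P k : F P -> risk l P k = (fine (risk l P k))%:E.
  move=> /(riskL _ k) /andP[r0 rL]; rewrite fineK// ge0_fin_numE//.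
  by rewrite (le_lt_trans rL)// ltry.
have [v valueE] : exists v, max_risk l F delta = v%:E.
  exists (fine (max_risk l F delta)); rewrite fineK// ge0_fin_numE.
    apply: (@le_lt_trans _ _ L%:E); rewrite ?ltry//.
    by apply: max_risk_le => P /(riskL _ delta) /andP[].
  apply: le_trans (risk_le_max_risk l F delta P0 FP0).
  by case/andP: (riskL _ delta FP0).
pose excess P (k : R.-pker T ~> A) : R := (fine (risk l P k) - v)%R.
have excess_mix : mixable [set` s] excess setT.
  move=> t k1 k2 t01 _ _; have [k mix] := exists_pker_mixture t k1 k2 t01.
  exists k => // P /= /FsP FP; rewrite /excess.
  rewrite (risk_mixture l P t k k1 k2) //; first last.
  - by move=> a; case/andP: (l_bounded _ a FP).
  - exact: l_meas.
  by rewrite (risk_fin P k1)// (risk_fin P k2)//= ; ring.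
have excess_max k : setT k -> exists2 P, P \in s & (0 <= excess P k)%R.
  move=> _; apply: contrapT => no_excess.
  have lt_v P : P \in s -> risk l P k < v%:E.
    move=> Ps; rewrite risk_fin ?lte_fin; last exact: FsP.
    rewrite ltNge; apply/negP => vr; apply: no_excess; exists P => //.
    by rewrite /excess subr_ge0.
  (* Finiteness of F is what makes the maximal risk of k strictly below v. *)
  have : \big[Order.max/-oo]_(P <- s) risk l P k < v%:E.
    by rewrite big_seq; apply: bigmax_lt; rewrite ?ltNyr.
  apply/negP; rewrite -leNgt -valueE minimax.
  apply: (@le_trans _ _ (max_risk l F k)).
    by apply: ereal_inf_lbound; exists k.
  apply: max_risk_le => P FP; apply: (le_bigmax_seq -oo P xpredT (fun Q => risk l Q k)) => //.
  by rewrite sF mem_set.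
have [|mu [mu0 mus mu1 mu_excess]] := mixable_max_ge0 s excess setT
    (fset_uniq _) _ excess_mix excess_max; first by exists delta.
have bayesE k : bayes_risk l F mu k
    = (\sum_(P <- s) mu P * fine (risk l P k))%:E.
  rewrite /bayes_risk fsbig_finite// -sumEFin; apply: eq_big_seq => P /FsP FP.
  by rewrite risk_fin.
exists mu; split.
  split => //.
  - by move=> P FP; apply: mus; rewrite sF notin_setE.
  - by rewrite fsbig_finite.
move=> k; apply: (@le_trans _ _ v%:E); rewrite bayesE lee_fin.
  rewrite -[leRHS]mul1r -mu1 mulr_suml big_seq [leRHS]big_seq.
  apply: ler_sum => P /FsP FP; rewrite ler_wpM2l//.
  by rewrite -lee_fin -risk_fin// -valueE risk_le_max_risk.
have := mu_excess k I; rewrite /excess.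
under eq_bigr do rewrite mulrBr.
by rewrite sumrB -mulr_suml mu1 mul1r subr_ge0.
Qed.

Theorem theorem7p2 (R : realType)
  (d : nat -> measure_display) (X : forall n, measurableType (d n))
  (dA : measure_display) (A : measurableType dA)
  (PP : forall n, set (probability (X n) R))
  (nu : forall n, {measure set (X n) -> \bar R})
  (l : forall n, probability (X n) R -> A -> R)
  (L c : nat -> R) (r : R)
  (PK : forall n, R -> set (probability (X n) R))
  (PP_neq0 : forall n, PP n !=set0)
  (PP_density : forall n P, PP n P -> has_density (nu n) P)
  (l_meas : forall n P, PP n P -> measurable_fun setT (l n P))
  (l_bounded : forall n P a, PP n P -> (0 <= l n P a <= L n)%R)
  (A1 : forall n a P P', PP n P -> PP n P' ->
     `| l n P a - l n P' a |%:E <= (c n)%:E * variation_dist P P')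
  (A2 : forall n (eps : R), (0 < eps)%R ->
     [/\ finite_set (PK n eps), PK n eps `<=` PP n &
         ereal_sup [set ereal_inf [set variation_dist P P' | P' in PK n eps]
                   | P in PP n] <= eps%:E])
  (A3 : forall n, (exists delta, is_minimax (l n) (PP n) delta)
                  /\ minimax_risk (l n) (PP n) <= r%:E)
  (* attainment on the finite models, implicit in the use of Bayes procedures *)
  (PK_minimax : forall n (eps : R), (0 < eps)%R ->
     exists delta, is_minimax (l n) (PK n eps) delta) :
  forall n (eps' : R), (0 < eps')%R ->
    exists (F : set (probability (X n) R)) (mu : probability (X n) R -> R),
      finite_prior (PP n) F mu /\
      exists delta, is_bayes (l n) F mu delta /\
        max_risk (l n) (PP n) delta <= minimax_risk (l n) (PP n) + eps'%:E.
Proof.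
move=> n eps' eps'0.
have L0 : (0 <= L n)%R.
  have [P PPP] := PP_neq0 n.
  by case/andP: (l_bounded n P point PPP) => /le_trans; apply.
pose K : R := (`|c n| + L n + 1)%R.
have K0 : (0 < K)%R by rewrite ltr_wpDl// addr_ge0.
(* The factor 2 pays for choosing a point of the net at distance below 2 * eps
   from an infimum that is at most eps; the summand 1 keeps K positive. *)
pose eps : R := (eps' / (K * 2))%R.
have eps0 : (0 < eps)%R by rewrite divr_gt0// mulr_gt0.
have [finF FPP net] := A2 n eps eps0.
set F := PK n eps in finF FPP net.
have near P : PP n P -> exists2 Q, F Q & variation_dist P Q <= (2 * eps)%:E.
  move=> PPP.
  have /ereal_inf_lt[_ [Q FQ <-] PQ] :
      ereal_inf [set variation_dist P P' | P' in F] < (2 * eps)%:E.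
    apply: (@le_lt_trans _ _ eps%:E).
      by apply: le_trans net; apply: ereal_sup_ubound; exists P.
    by rewrite lte_fin; lra.
  by exists Q => //; exact: ltW.
have F0 : F !=set0.
  by have [P /near[Q FQ _]] := PP_neq0 n; exists Q.
have [delta minimaxF] := PK_minimax n eps eps0.
have [mu [[_ _ mu_ge0 mu_out mu1] bayes]] :=
  exists_least_favorable_prior (l n) F (L n) delta finF F0
    (fun P FP => l_meas n P (FPP P FP))
    (fun P a FP => l_bounded n P a (FPP P FP)) minimaxF.
exists F, mu; split; first by split.
exists delta; split => //.
apply: max_risk_le => P PPP.
have [Q FQ PQ] := near P PPP.
have PPQ := FPP Q FQ.
apply: le_trans (risk_le_add_variation_dist (l n) P Q delta (L n) (c n)
  (2 * eps)%R (l_meas n P PPP) (l_meas n Q PPQ) _ _ _ PQ _) _.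
- by move=> a; case/andP: (l_bounded n P a PPP).
- by move=> a; exact: l_bounded.
- by rewrite mulr_ge0// ltW.
- by move=> a; exact: A1.
apply: leeD.
  apply: le_trans (le_minimax_risk (l n) F (PP n) FPP).
  by rewrite -minimaxF risk_le_max_risk.
rewrite lee_fin.
have -> : eps' = (K * (2 * eps))%R by rewrite /eps; field; rewrite gt_eqF.
by apply: ler_wpM2r; [rewrite mulr_ge0// ltW|rewrite /K lerDl].
Qed.
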